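(* Let $(X,\tau)$ be an uncountable Polish space and $2\le\xi<\omega_1$. Then for every Baire class $\xi$ function $f:X\to\mathbb{R}$, $\overline{\alpha}_\xi(f)\le\overline{\beta}_\xi(f)\le\overline{\gamma}_\xi(f)\le\omega$.
   Context: For a rank $\rho$ on Baire class $1$ functions on $X$, the limit ranks $\overline\rho_\xi$ on Baire class $\xi$ functions are defined inductively: $\overline\rho_1=\rho$; $\overline\rho_{\xi+1}(f)=\min\{\sup_n\overline\rho_\xi(f_n): f_n\to f \text{ pointwise}, f_n \text{ Baire class } \xi\}$; for limit $\xi$, $\overline\rho_\xi(f)=\min\{\sup_n\overline\rho_{\xi_n}(f_n): f_n\to f\text{ pointwise}, \xi_n<\xi, f_n \text{ Baire class }\xi_n \text{ and not Baire class } \zeta \text{ for any } \zeta<\xi_n\}$. The base ranks: a derivative on closed subsets of $X$ is a map $D$ from closed sets to closed sets with $D(A)\subseteq A$ and monotone; iterates $D^0(F)=F$, $D^{\eta+1}(F)=D(D^\eta(F))$, intersections at limits; $\mathrm{rk}(D)$ is the least $\eta$ with $D^\eta(X)=\emptyset$ ($\omega_1$ if none). $\alpha(f)=\sup_{p<q\in\mathbb{Q}}\mathrm{rk}(D_{A,B})$ with $A=\{f\le p\}$, $B=\{f\ge q\}$, $D_{A,B}(F)=\overline{F\cap A}\cap\overline{F\cap B}$. $\beta(f)=\sup_{\varepsilon>0}\mathrm{rk}(D_{f,\varepsilon})$ with $D_{f,\varepsilon}(F)=\{x\in F:\omega(f,x,F)\ge\varepsilon\}$, $\omega(f,x,F)=\inf\{\sup_{x_1,x_2\in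 U\cap F}|f(x_1)-f(x_2)|:U\ni x\text{ open}\}$. $\gamma(f)=\min\{\sup_{\varepsilon>0}\mathrm{rk}(D_{(f_n),\varepsilon}): f_n\text{ continuous}, f_n\to f\}$ with $D_{(f_n),\varepsilon}(F)=\{x\in F: \inf_{U\ni x\text{ open}}\inf_N\sup\{|f_m(y)-f_n(y)|:n,m\ge N, y\in U\cap F\}\ge\varepsilon\}$. *)

(* Defs.v *)
From HB Require Import structures.
From mathcomp Require Import all_boot all_order all_algebra.
From mathcomp Require Import all_classical all_reals all_analysis.
From mathcomp Require wochoice.
Set Implicit Arguments.
Unset Strict Implicit.
Unset Printing Implicit Defensive.
Import Order.TTheory GRing.Theory Num.Theory.
Import numFieldNormedType.Exports.
Local Open Scope order_scope.
Local Open Scope classical_set_scope.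

(* The ordinals up to and including omega_1.  A countable ordinal is an element
   of a fixed well-ordering of [set nat] having only countably many elements
   below it; omega_1 is a top element placed above all of these.  The facts
   [ord_min_ex], [countable_ord_below] and [uncountable_ord_below_top] pin
   the order type down to omega_1 + 1. *)
Definition wo_le : rel (set nat) :=
  sval (wochoice.well_ordering_principle (set nat)).

Definition countable_ord : Type :=
  {x : set nat | `[< countable [set y : set nat | wo_le y x] >]}.

HB.instance Definition _ := Choice.on countable_ord.

Definition Ord1 : Type := option countable_ord.

HB.instance Definition _ := Choice.on Ord1.

Definition ord_le (a b : Ord1) : bool :=
  match a, b with
  | _, None => true
  | None, Some _ => false
  | Some x, Some y => wo_le (sval x) (sval y)
  end.

Lemma wo_le_min (A : set (set nat)) : A !=set0 ->
  exists2 z, A z & forall y, A y -> wo_le z y.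
Proof.
move=> [a Aa].
have [|z [[zA zmin] _]] := svalP (wochoice.well_ordering_principle (set nat))
  (fun x => `[< A x >]); first by exists a; apply/asboolP.
by exists z; [move/asboolP : zA | move=> y Ay; apply: zmin; apply/asboolP].
Qed.

Lemma wo_le_total : total wo_le.
Proof.
move=> x y; have [|z] := @wo_le_min [set x; y]; first by exists x; left.
by move=> [] -> zmin; apply/orP; [left|right]; apply: zmin; [right|left].
Qed.

Lemma wo_le_refl : reflexive wo_le.
Proof. by move=> x; have /orP[] := wo_le_total x x. Qed.

Lemma wo_le_anti : antisymmetric wo_le.
Proof.
move=> x y /andP[xy yx].
have [|z [_ zu]] := svalP (wochoice.well_ordering_principle (set nat))
  (fun t => `[< t = x \/ t = y >]); first by exists x; apply/asboolP; left.
transitivity z; [symmetry|]; apply: zu; split=> //=.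
- by apply/asboolP; left.
- by move=> t /asboolP[] -> //; apply: wo_le_refl.
- by apply/asboolP; right.
- by move=> t /asboolP[] -> //; apply: wo_le_refl.
Qed.

Lemma wo_le_trans : transitive wo_le.
Proof.
move=> y x z xy yz; have [|t] := @wo_le_min [set x; y; z].
  by exists x; left; left.
move=> [[]|] -> tmin.
- by apply: tmin; right.
- have yx : wo_le y x by apply: tmin; left; left.
  by rewrite (wo_le_anti (x := x) (y := y)) ?xy.
- have zy : wo_le z y by apply: tmin; left; right.
  by rewrite -(wo_le_anti (x := y) (y := z)) ?yz.
Qed.

Lemma ord_le_refl : reflexive ord_le.
Proof. by case=> //= x; apply: wo_le_refl. Qed.

Lemma ord_le_anti : antisymmetric ord_le.
Proof.
move=> [x|] [y|] //= /wo_le_anti xy; congr Some; exact: val_inj.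
Qed.

Lemma ord_le_trans : transitive ord_le.
Proof. move=> [y|] [x|] [z|] //=; apply: wo_le_trans. Qed.

Fact ord_display : Order.disp_t. Proof. exact: Order.Disp tt tt. Qed.

HB.instance Definition _ := @Order.Le_isPOrder.Build ord_display Ord1
  ord_le ord_le_refl ord_le_anti ord_le_trans.

Lemma ord_le_total : total (<=%O : rel Ord1).
Proof.
by move=> [x|] [y|] //=; rewrite /Order.le /=; apply: wo_le_total.
Qed.

HB.instance Definition _ :=
  @Order.POrder_isTotal.Build ord_display Ord1 ord_le_total.

Lemma ord_min_ex (A : set Ord1) : A !=set0 -> (A `&` lbound A) !=set0.
Proof.
move=> [a Aa]; pose B := [set x : set nat | exists2 c : countable_ord,
  sval c = x & A (Some c)].
have [[b Bb]|B0] := pselect (B !=set0).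
  have [_ [c <- Ac] cmin] := wo_le_min (ex_intro _ b Bb).
  by exists (Some c); split=> // -[d|]// Ad; apply: cmin; exists d.
case: a Aa => [c Ac|AN]; first by case: B0; exists (sval c); exists c.
exists None; split=> // -[d Ad|//]; by case: B0; exists (sval d); exists d.
Qed.

Lemma ord_top_ge (x : Ord1) : x <= None. Proof. by case: x. Qed.

HB.instance Definition _ := @Order.hasTop.Build ord_display Ord1 None ord_top_ge.

Lemma ord_zero_ex : {z : Ord1 | forall x, z <= x}.
Proof.
by apply: cid; have [|z [_ zmin]] := @ord_min_ex setT;
  [exists None|exists z => x; apply: zmin].
Qed.

HB.instance Definition _ := @Order.hasBottom.Build ord_display Ord1
  (sval ord_zero_ex) (svalP ord_zero_ex).

Lemma ord_lt_wf : well_founded (fun x y : Ord1 => x < y).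
Proof.
move=> a; apply: contrapT => nAa.
have [|z [nAz zmin]] := @ord_min_ex [set x | ~ Acc (fun x y : Ord1 => x < y) x].
  by exists a.
apply: nAz; constructor => y yz; apply: contrapT => /zmin.
by rewrite leNgt yz.
Qed.

Lemma countable_ord_below (x : Ord1) : x < \top -> countable [set y | y < x].
Proof.
case: x => [c _|]; last by rewrite ltxx.
have /asboolP/countable_injP[f finj] := svalP c.
apply/countable_injP; exists (fun y => if y is Some d then f (sval d) else 0%N).
move=> [d|] [e|]; rewrite !inE => /ltW// dc /ltW// ec def.
by congr Some; apply: val_inj; apply: finj => //; rewrite inE.
Qed.

Lemma uncountable_ord_below_top : ~ countable [set y : Ord1 | y < \top].
Proof.
move=> /countable_injP[g ginj].
pose S := [set x : set nat | countable [set y | wo_le y x]].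
have cS : countable S.
  apply/countable_injP; exists (fun x =>
    if pselect (`[< countable [set y | wo_le y x] >]) is left h
    then g (Some (exist _ x h)) else 0%N) => x y /set_mem/asboolT Sx /set_mem/asboolT Sy.
  case: pselect => [hx|/(_ Sx)//]; case: pselect => [hy|/(_ Sy)//].
  have in_lt (c : countable_ord) : Some c \in [set y : Ord1 | y < \top].
    by rewrite inE /= lt_neqAle lex1 andbT.
  by move=> /(ginj _ _ (in_lt _) (in_lt _)) [].
have [ST|/existsNP[z0 Sz0]] := pselect (forall x, S x); last first.
  have [|z Sz zmin] := @wo_le_min (~` S); first by exists z0.
  apply: Sz; apply: (@sub_countable _ _ _ (S `|` [set z])).
    apply: subset_card_le => y yz; have [Sy|nSy] := pselect (S y); first by left.
    by right; apply: wo_le_anti; rewrite yz zmin.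
  have -> : (S `|` [set z])%classic = \bigcup_(b in [set: bool]) if b then S else [set z].
    apply/seteqP; split=> [y [Sy|zy]|y [[] _ yb]].
    - by exists true.
    - by exists false.
    - by left.
    - by right.
  by apply: bigcup_countable => // -[] _; [exact: cS|exact: countable1].
have /countable_injP[f finj] : countable [set: set nat].
  by apply: sub_countable cS; apply: subset_card_le => y _; apply: ST.
pose D := [set n | exists2 A, f A = n & ~ A n].
have [DD|nDD] := pselect (D (f D)); last by apply: (nDD); exists D.
by have [A /finj ->] := DD; rewrite ?inE.
Qed.

(* The least element; since every nonempty set has one, the default value
   omega_1 is returned only on the empty set. *)
Definition ord_min (A : set Ord1) : Ord1 := xget \top (A `&` lbound A).

Definition ord_sup (A : set Ord1) : Ord1 := supremum \bot A.

Lemma ord_minP (A : set Ord1) : A !=set0 ->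
  A (ord_min A) /\ forall x, A x -> ord_min A <= x.
Proof. by move=> /ord_min_ex/xgetPex-/(_ \top). Qed.

Lemma ord_supP (A : set Ord1) (u : Ord1) :
  (ord_sup A <= u) <-> (forall x, A x -> x <= u).
Proof.
rewrite /ord_sup /supremum; case: ifPn => [/eqP->|/set0P[a Aa]].
  by rewrite le0x; split.
have /(xgetPex \bot)[Aub Alub] : supremums A !=set0.
  have [|z [zub zlub]] := @ord_min_ex (ubound A); first by exists \top => x _.
  by exists z; split.
split=> [Au x Ax|Au]; last exact: Alub.
by apply: le_trans Au; apply: Aub.
Qed.

Definition ord_succ (x : Ord1) : Ord1 := ord_min [set y | x < y].

Definition ord_of_nat (n : nat) : Ord1 := iter n ord_succ \bot.

Definition ord_omega : Ord1 := ord_sup (range ord_of_nat).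

Definition limit_ord (x : Ord1) : Prop :=
  x != \bot /\ forall y, y < x -> ord_succ y < x.

Lemma ord_succ_le (x y : Ord1) : x < y -> ord_succ x <= y.
Proof.
by move=> xy; have [_] := @ord_minP [set y | x < y] (ex_intro _ y xy); apply.
Qed.

Lemma ord_lt_succ (x : Ord1) : x < \top -> x < ord_succ x.
Proof.
by move=> xT; have [] := @ord_minP [set y | x < y] (ex_intro _ \top xT).
Qed.

(* Transfinite recursion with separate zero, successor and limit clauses.  In
   the limit clause only the values below the current ordinal are meaningful,
   see [ord_rec_limit]. *)
Definition ord_rec (P : Type) (z : P) (s : Ord1 -> P -> P)
    (l : Ord1 -> (Ord1 -> P) -> P) : Ord1 -> P :=
  Fix ord_lt_wf (fun=> P) (fun x below =>
    let r y := if pselect (y < x) is left yx then below y yx else z in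
    if x == \bot then z
    else if pselect (exists2 y, y < x & x = ord_succ y) is left ex_pred
    then let y := sval (cid2 ex_pred) in s y (r y)
    else l x r).

Section ord_rec_equations.
Context (P : Type) (z : P) (s : Ord1 -> P -> P) (l : Ord1 -> (Ord1 -> P) -> P).

Let ord_recE (x : Ord1) :
  let r y := if pselect (y < x) is left _ then ord_rec z s l y else z in
  ord_rec z s l x =
    if x == \bot then z
    else if pselect (exists2 y, y < x & x = ord_succ y) is left ex_pred
    then let y := sval (cid2 ex_pred) in s y (r y)
    else l x r.
Proof.
move=> r; rewrite [LHS]/ord_rec Fix_eq; last first.
  move=> y g h gh; suff -> : g = h by [].
  by apply/functional_extensionality_dep => t;
    apply/functional_extensionality_dep => p; exact: gh.
by [].
Qed.

Lemma ord_rec0 : ord_rec z s l \bot = z.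
Proof. by rewrite ord_recE eqxx. Qed.

Lemma ord_rec_succ (x : Ord1) : x < \top ->
  ord_rec z s l (ord_succ x) = s x (ord_rec z s l x).
Proof.
move=> xT; have xSx := ord_lt_succ xT; rewrite ord_recE.
case: eqP => [S0|_]; first by move: xSx; rewrite S0 ltx0.
case: pselect => [ex|[]]; last by exists x.
case: cid2 => y yS /= Sxy.
have -> : y = x.
  apply/eqP; rewrite eq_le !leNgt; apply/andP; split; apply/negP.
    by move=> /ord_succ_le; rewrite leNgt yS.
  move=> /ord_succ_le; rewrite -Sxy leNgt xSx //.
by case: pselect.
Qed.

Lemma ord_rec_limit (x : Ord1) :
  (forall r r', (forall y, y < x -> r y = r' y) -> l x r = l x r') ->
  limit_ord x -> ord_rec z s l x = l x (ord_rec z s l).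
Proof.
move=> lext [x0 xlim]; rewrite ord_recE (negbTE x0).
case: pselect => [[y yx xS]|_]; first by have := xlim _ yx; rewrite -xS ltxx.
by apply: lext => y yx; case: pselect.
Qed.

End ord_rec_equations.

Section polish.
Context (R : realType) (X : topologicalType).

Definition compatible_metric (d : X -> X -> R) : Prop :=
  [/\ forall x y, (0 <= d x y)%R,
      forall x y, d x y = 0%R <-> x = y,
      forall x y, d x y = d y x,
      forall x y z, (d x z <= d x y + d y z)%R &
      forall x (A : set X), nbhs x A <->
        exists2 e : R, (0 < e)%R & [set y | (d x y < e)%R] `<=` A].

Definition complete_metric (d : X -> X -> R) : Prop :=
  forall u : nat -> X,
    (forall e : R, (0 < e)%R -> exists N, forall m n,
      (N <= m)%N -> (N <= n)%N -> (d (u m) (u n) < e)%R) ->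
    exists x : X, u n @[n --> \oo] --> x.

Definition polish_space : Prop :=
  (exists2 D : set X, countable D & dense D) /\
  exists2 d : X -> X -> R, compatible_metric d & complete_metric d.

End polish.

Section ranks.
Context (R : realType) (X : topologicalType).
Implicit Types (f : X -> R) (fs : nat -> X -> R) (F : set X) (D : set X -> set X).

Definition pointwise_cvg fs f : Prop := forall x, fs n x @[n --> \oo] --> f x.

(* Baire class 0 is the class of continuous functions. *)
Inductive baire_class : Ord1 -> (X -> R) -> Prop :=
| Baire0 f : continuous f -> baire_class \bot f
| BaireLim (xi : Ord1) (xis : nat -> Ord1) fs f :
    (forall n, xis n < xi) -> (forall n, baire_class (xis n) (fs n)) ->
    pointwise_cvg fs f -> baire_class xi f.

(* Maps on all subsets stand for maps on closed subsets: only their values on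
   closed sets matter below. *)
Definition derivative D : Prop :=
  [/\ forall F, closed F -> closed (D F),
      forall F, closed F -> D F `<=` F &
      forall F G, closed F -> closed G -> F `<=` G -> D F `<=` D G].

Definition iter_derivative D F : Ord1 -> set X :=
  ord_rec F (fun _ => D) (fun x DF => \bigcap_(y in [set y | y < x]) DF y).

(* [ord_min set0] is omega_1. *)
Definition derivative_rank D : Ord1 :=
  ord_min [set x | iter_derivative D setT x = set0].

Definition separation_derivative (A B : set X) F : set X :=
  closure (F `&` A) `&` closure (F `&` B).

Definition alpha_rank f : Ord1 :=
  ord_sup [set derivative_rank (separation_derivative
             [set x | (f x <= ratr pq.1)%R] [set x | (ratr pq.2 <= f x)%R])
          | pq in [set pq : rat * rat | (pq.1 < pq.2)%R]].

Definition oscillation f (x : X) F : \bar R :=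
  ereal_inf [set ereal_sup [set `|f y.1 - f y.2|%R%:E
                           | y in (U `&` F) `*` (U `&` F)]
            | U in open_nbhs x].

Definition oscillation_derivative f (e : R) F : set X :=
  F `&` [set x | (e%:E <= oscillation f x F)%E].

Definition beta_rank f : Ord1 :=
  ord_sup [set derivative_rank (oscillation_derivative f e)
          | e in [set e : R | (0 < e)%R]].

Definition tail_oscillation fs (x : X) F : \bar R :=
  ereal_inf [set ereal_inf [set ereal_sup
      [set r | exists m n y, [/\ (N <= m)%N, (N <= n)%N, (U `&` F) y &
                                r = `|fs m y - fs n y|%R%:E]]
    | N in [set: nat]] | U in open_nbhs x].

Definition convergence_derivative fs (e : R) F : set X :=
  F `&` [set x | (e%:E <= tail_oscillation fs x F)%E].

Definition gamma_rank f : Ord1 :=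
  ord_min [set x | exists fs, [/\ forall n, continuous (fs n : X -> R),
    pointwise_cvg fs f &
    x = ord_sup [set derivative_rank (convergence_derivative fs e)
                | e in [set e : R | (0 < e)%R]]]].

(* The hierarchy starts with [rho] at 1, hence the test [xi == \bot] in the
   successor clause; the value at 0 is a junk value.  In the limit clause, every
   [fs n] comes with its exact Baire class [xis n], which is nonzero since there
   is no limit rank at 0.  See [limit_rank1], [limit_rank_succ] and
   [limit_rank_limit]. *)
Definition limit_rank (rho : (X -> R) -> Ord1) : Ord1 -> (X -> R) -> Ord1 :=
  ord_rec rho
    (fun xi rho_xi => if xi == \bot then rho else fun f =>
      ord_min [set x | exists fs, [/\ forall n, baire_class xi (fs n),
        pointwise_cvg fs f & x = ord_sup (range (fun n => rho_xi (fs n)))]])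
    (fun xi rho_ f =>
      ord_min [set x | exists fs (xis : nat -> Ord1),
        [/\ forall n, \bot < xis n < xi,
            forall n, baire_class (xis n) (fs n),
            forall n zeta, zeta < xis n -> ~ baire_class zeta (fs n),
            pointwise_cvg fs f &
            x = ord_sup (range (fun n => rho_ (xis n) (fs n)))]]).

Lemma separation_derivativeP (A B : set X) :
  derivative (separation_derivative A B).
Proof.
split=> [F _|F cF x [cx _]|F G _ _ FG x [Ax Bx]].
- by apply: closedI; apply: closed_closure.
- by rewrite ((closure_id F).1 cF); apply: closure_subset cx => y [].
- by split; [move: Ax|move: Bx]; apply: closure_subset => y [/FG].
Qed.

Let inf_le (I : Type) (A : set I) (v w : I -> \bar R) :
  (forall i, A i -> (v i <= w i)%E) ->
  (ereal_inf (v @` A) <= ereal_inf (w @` A))%E.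
Proof.
move=> vw; apply: le_ereal_inf_tmp => _ [i Ai <-].
by apply: le_trans (vw i Ai); apply: ereal_inf_lbound; exists i.
Qed.

Let derivative_of_local (w : X -> set X -> \bar R) (e : R) :
  (forall F x, (w x F < e%:E)%E ->
    exists2 U, open_nbhs x U & forall y, U y -> (w y F < e%:E)%E) ->
  (forall F G x, F `<=` G -> (w x F <= w x G)%E) ->
  derivative (fun F => F `&` [set x | (e%:E <= w x F)%E]).
Proof.
move=> wlocal wmono; split=> [F cF x clx|F _ x []//|F G _ _ FG x [Fx ex]].
  split; first by apply: cF; apply: closure_subset clx => y [].
  rewrite /= leNgt; apply/negP => /wlocal[U xU Ulow].
  have [y [[_ ey] Uy]] := clx U (open_nbhs_nbhs xU).
  by have := Ulow y Uy; rewrite ltNge ey.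
by split; [exact: FG | apply: le_trans ex _; exact: wmono].
Qed.

Lemma oscillation_derivativeP f (e : R) :
  derivative (oscillation_derivative f e).
Proof.
apply: derivative_of_local => [F x|F G x FG].
  move=> /ereal_inf_lt[_ [U [oU Ux] <-] Ue]; exists U => // y Uy.
  by apply: le_lt_trans Ue; apply: ereal_inf_lbound; exists U => //; split.
apply: inf_le => U _; apply: ereal_sup_le => _ [y [[U1 F1] [U2 F2]] <-].
by exists y => //; split; split=> //; apply: FG.
Qed.

Lemma convergence_derivativeP fs (e : R) :
  derivative (convergence_derivative fs e).
Proof.
apply: derivative_of_local => [F x|F G x FG].
  move=> /ereal_inf_lt[_ [U [oU Ux] <-] Ue]; exists U => // y Uy.
  by apply: le_lt_trans Ue; apply: ereal_inf_lbound; exists U => //; split.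
apply: inf_le => U _; apply: inf_le => N _.
apply: ereal_sup_le => _ [m [n [y [Nm Nn [Uy Fy] ->]]]].
by exists m, n, y; split=> //; split=> //; apply: FG.
Qed.

Lemma iter_derivative0 D F : iter_derivative D F \bot = F.
Proof. exact: ord_rec0. Qed.

Lemma iter_derivative_succ D F (x : Ord1) : x < \top ->
  iter_derivative D F (ord_succ x) = D (iter_derivative D F x).
Proof. exact: ord_rec_succ. Qed.

Lemma iter_derivative_limit D F (x : Ord1) : limit_ord x ->
  iter_derivative D F x =
  \bigcap_(y in [set y | y < x]) iter_derivative D F y.
Proof. by apply: ord_rec_limit => r r' rr'; apply: eq_bigcapr. Qed.

Lemma limit_rank1 rho : limit_rank rho (ord_of_nat 1) = rho.
Proof.
rewrite /limit_rank /= ord_rec_succ ?eqxx//.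
have := @uncountable_ord_below_top; rewrite lt_neqAle lex1 andbT => unc.
apply/eqP => bT; apply: unc; rewrite (_ : mkset _ = set0)//.
by apply/seteqP; split=> // y /=; rewrite -bT ltx0.
Qed.

Lemma limit_rank_succ rho (xi : Ord1) f : \bot < xi < \top ->
  limit_rank rho (ord_succ xi) f =
  ord_min [set x | exists fs, [/\ forall n, baire_class xi (fs n),
    pointwise_cvg fs f &
    x = ord_sup (range (fun n => limit_rank rho xi (fs n)))]].
Proof.
by move=> /andP[xi0 xiT]; rewrite /limit_rank ord_rec_succ// gt_eqF.
Qed.

Lemma limit_rank_limit rho (xi : Ord1) f : limit_ord xi ->
  limit_rank rho xi f =
  ord_min [set x | exists fs (xis : nat -> Ord1),
    [/\ forall n, \bot < xis n < xi,
        forall n, baire_class (xis n) (fs n),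
        forall n zeta, zeta < xis n -> ~ baire_class zeta (fs n),
        pointwise_cvg fs f &
        x = ord_sup (range (fun n => limit_rank rho (xis n) (fs n)))]].
Proof.
move=> xilim; rewrite {1}/limit_rank ord_rec_limit// => r r' rr'.
have rE (xis : nat -> Ord1) fs : (forall n, \bot < xis n < xi) ->
    (fun n => r (xis n) (fs n)) = (fun n => r' (xis n) (fs n)).
  by move=> xiP; apply/funext => n; rewrite rr'//; case/andP: (xiP n).
apply/funext => g; congr ord_min; apply/seteqP; split=> x
  [fs [xis [xiP ? ? ? ->]]]; exists fs, xis; split=> //; by rewrite rE.
Qed.

End ranks.

Arguments alpha_rank {R X} f.
Arguments beta_rank {R X} f.
Arguments gamma_rank {R X} f.

(* Main.v *)
(* The inequalities between the limit ranks follow by transfinite induction from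
   alpha <= beta <= gamma, which hold because one step of the alpha-derivative is
   contained in a step of a beta-derivative, and the latter in a step of any
   gamma-derivative with a smaller epsilon.

   For the bound by omega, call a function stratified if it is a limit of
   continuous functions that is locally eventually constant on each stratum of a
   finite filtration by closed sets; each step of the gamma-derivative then
   removes a stratum, so gamma is at most omega.  A Baire class 2 function
   f = lim f_n is a pointwise limit of stratified functions: cover X by countably
   many closed sets on which f_n is within 1/(n+1) of a constant, and at stage N
   evaluate at x the best of the first N approximations for which x lies in one
   of the first N sets.  This settles class 2, and successors are immediate.  At
   limits the only issue is that the approximating functions must have exact class
   at least 2 to apply the induction hypothesis; one adds g/(n+1) with g of class
   2 and not 1.  If there is no such g, the hierarchy collapses to class 1, and f
   is directly a limit of discontinuous stratified functions, obtained by adding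
   multiples of the indicator of a non-isolated point. *)
Require Import Defs.
From mathcomp Require Import all_boot all_order all_algebra.
From mathcomp Require Import all_classical all_reals all_analysis.
Import Order.TTheory GRing.Theory Num.Theory.
Local Open Scope order_scope.
Local Open Scope classical_set_scope.
From mathcomp Require Import ring lra zify.
Import numFieldNormedType.Exports.

(** * Ordinals, Baire classes and comparison of ranks *)

(** Otherwise the ordinals below [\top] would be [x] and its predecessors, a countable set. *)
Lemma ord_succ_lt_top (x : Ord1) : x < \top -> ord_succ x < \top.
Proof.
move=> xT; rewrite lt_neqAle lex1 andbT; apply/eqP => ST.
apply: uncountable_ord_below_top.
have -> : [set y : Ord1 | y < \top] = [set y | y < x] `|` [set x].
  apply/seteqP; split=> [y yT /=|y [yx|->//]]; last exact: lt_trans yx xT.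
  case: (ltgtP x y) => [xy|yx|->]; [|by left|by right].
  by move: (ord_succ_le xy); rewrite ST leNgt yT.
rewrite -bigcup2E; apply: bigcup_countable => // -[_|[_|n _]] //=.
exact: countable_ord_below xT.
Qed.

Lemma ord_of_nat_lt_top n : ord_of_nat n < \top.
Proof.
elim: n => [|n /ord_succ_lt_top//]; rewrite /= lt_neqAle lex1 andbT.
apply/eqP => bT; apply: uncountable_ord_below_top.
rewrite (_ : mkset _ = set0) ?countable0//.
by apply/seteqP; split=> // y /=; rewrite -bT ltx0.
Qed.

Lemma ord_lt_succE (x y : Ord1) : x < \top -> (y < ord_succ x) = (y <= x).
Proof.
move=> xT; apply/idP/idP => [|yx]; last exact: le_lt_trans yx (ord_lt_succ xT).
by apply: contraTT; rewrite -ltNge -leNgt => /ord_succ_le.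
Qed.

Lemma ord_of_nat_le_omega n : ord_of_nat n <= ord_omega.
Proof. by have /ord_supP := lexx ord_omega; apply; exists n. Qed.

Variant ord_spec : Ord1 -> Prop :=
| OrdZero : ord_spec \bot
| OrdSucc x : x < \top -> ord_spec (ord_succ x)
| OrdLimit x : limit_ord x -> ord_spec x.

Lemma ordP x : ord_spec x.
Proof.
have [->|x0] := eqVneq x \bot; first exact: OrdZero.
have [[y [yT ->]]|nS] := pselect (exists y, y < \top /\ x = ord_succ y).
  exact: OrdSucc.
apply: OrdLimit; split=> // y yx.
have yT : y < \top by apply: lt_le_trans yx (lex1 _).
rewrite lt_neqAle ord_succ_le// andbT; apply/eqP => Sx.
by apply: nS; exists y.
Qed.

Lemma ord_min_le (A : set Ord1) x : A x -> ord_min A <= x.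
Proof. by move=> Ax; apply: (ord_minP (ex_intro A x Ax)).2. Qed.

Lemma ord_min_mono (A B : set Ord1) :
  (forall y, B y -> exists2 x, A x & x <= y) -> ord_min A <= ord_min B.
Proof.
move=> AB; have [[b Bb]|B0] := pselect (B !=set0).
  have [/AB[x Ax xB] _] := ord_minP (ex_intro B b Bb).
  exact: le_trans (ord_min_le _ _ Ax) xB.
(* For empty [B], [ord_min B] takes its default value [\top]. *)
rewrite [leRHS]/ord_min xgetPN ?lex1// => x [Bx _]; by apply: B0; exists x.
Qed.

Lemma ord_sup_mono (I J : Type) (A : set I) (B : set J) (u : I -> Ord1) (v : J -> Ord1) :
  (forall i, A i -> exists2 j, B j & u i <= v j) ->
  ord_sup (u @` A) <= ord_sup (v @` B).
Proof.
move=> AB; apply/ord_supP => _ [i /AB[j Bj uv] <-]; apply: le_trans uv _.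
by have /ord_supP := lexx (ord_sup (v @` B)); apply; exists j.
Qed.

Lemma baire_classW {R : realType} {X : topologicalType} (x y : Ord1) (f : X -> R) :
  x <= y -> baire_class x f -> baire_class y f.
Proof.
rewrite le_eqVlt => /predU1P[->//|xy] xf.
by apply: (@BaireLim _ _ _ (fun=> x) (fun=> f)) => // t; apply: cvg_cst.
Qed.

Lemma baire_class0E {R : realType} {X : topologicalType} (f : X -> R) :
  baire_class \bot f <-> continuous f.
Proof.
split=> [bf|]; last exact: Baire0.
have: forall x, x = \bot -> baire_class x f -> continuous f.
  move=> x x0 xf; case: xf x0 => // {}x xs fs g /(_ 0%N) xlt _ _ x0.
  by move: xlt; rewrite x0 ltx0.
by move/(_ _ erefl); apply.
Qed.

Lemma baire_classP {R : realType} {X : topologicalType} (x : Ord1) (f : X -> R) :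
  \bot < x -> baire_class x f ->
  exists (xs : nat -> Ord1) fs, [/\ forall n, xs n < x,
    forall n, baire_class (xs n) (fs n) & pointwise_cvg fs f].
Proof.
move=> x0 xf; case: xf x0 => [g _|{}x xs fs g ? ? ? _]; first by rewrite ltxx.
by exists xs, fs.
Qed.

Lemma ord_lt_0_1 : \bot < ord_of_nat 1.
Proof. by have := ord_lt_succ (ord_of_nat_lt_top 0). Qed.

Lemma baire_class_succP {R : realType} {X : topologicalType} (x : Ord1) (f : X -> R) :
  x < \top -> baire_class (ord_succ x) f <->
  exists2 fs, forall n, baire_class x (fs n) & pointwise_cvg fs f.
Proof.
move=> xT; split=> [/baire_classP[|xs [fs [xsx xfs fsf]]]|[fs xfs fsf]].
- exact: le_lt_trans (le0x _) (ord_lt_succ xT).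
- exists fs => // n; apply: baire_classW (xfs n).
  by rewrite -ord_lt_succE.
- by apply: (@BaireLim _ _ _ (fun=> x)) fsf => // n; apply: ord_lt_succ.
Qed.

Lemma baire_class1P {R : realType} {X : topologicalType} (f : X -> R) :
  baire_class (ord_of_nat 1) f <->
  exists2 fs : nat -> X -> R, forall n, continuous (fs n) & pointwise_cvg fs f.
Proof.
rewrite (baire_class_succP _ _ (ord_of_nat_lt_top 0)).
by split=> -[fs cfs fsf]; exists fs => // n; apply/baire_class0E.
Qed.

Lemma baire_class1_lin {R : realType} {X : topologicalType} (a : R) (f g : X -> R) :
  baire_class (ord_of_nat 1) f -> baire_class (ord_of_nat 1) g ->
  baire_class (ord_of_nat 1) (fun x => f x + a * g x)%R.
Proof.
move=> /baire_class1P[fs cfs fsf] /baire_class1P[gs cgs gsg].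
apply/baire_class1P; exists (fun n x => fs n x + a * gs n x)%R.
  by move=> n x; apply: cvgD; [exact: cfs|apply: cvgMr; exact: cgs].
by move=> x; apply: cvgD; [exact: fsf|apply: cvgMr; exact: gsg].
Qed.

Lemma baire_class2_lin {R : realType} {X : topologicalType} (a : R) (f g : X -> R) :
  baire_class (ord_of_nat 2) f -> baire_class (ord_of_nat 2) g ->
  baire_class (ord_of_nat 2) (fun x => f x + a * g x)%R.
Proof.
rewrite !(baire_class_succP _ _ (ord_of_nat_lt_top 1)).
move=> [fs cfs fsf] [gs cgs gsg]; exists (fun n x => fs n x + a * gs n x)%R.
  by move=> n; apply: baire_class1_lin.
by move=> x; apply: cvgD; [exact: fsf|apply: cvgMr; exact: gsg].
Qed.

(** Both limit ranks minimise over the same approximating sequences, so a comparison of the base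
    ranks passes through every supremum and minimum. *)
Lemma limit_rank_mono {R : realType} {X : topologicalType} (rho rho' : (X -> R) -> Ord1) :
  (forall f, rho f <= rho' f) ->
  forall x f, limit_rank rho x f <= limit_rank rho' x f.
Proof.
move=> rr' x; elim/(well_founded_ind ord_lt_wf): x => x.
case: x / ordP => [_ f|x xT IH f|x xlim IH f].
- by rewrite /limit_rank !ord_rec0.
- have [->|x0] := eqVneq x \bot; first by rewrite !limit_rank1.
  have xb : \bot < x < \top by rewrite lt0x x0.
  rewrite !limit_rank_succ//; apply: ord_min_mono => _ [fs [xfs fsf ->]].
  exists (ord_sup (range (fun n => limit_rank rho x (fs n)))); first by exists fs.
  apply: ord_sup_mono => n _; exists n => //; exact/IH/ord_lt_succ.
- rewrite !limit_rank_limit//.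
  apply: ord_min_mono => _ [fs [xs [xsx xfs xfs' fsf ->]]].
  exists (ord_sup (range (fun n => limit_rank rho (xs n) (fs n)))).
    by exists fs, xs.
  by apply: ord_sup_mono => n _; exists n => //; apply: IH; case/andP: (xsx n).
Qed.

Lemma closed_iter_derivative {X : topologicalType} (D : set X -> set X) F x :
  derivative D -> closed F -> closed (iter_derivative D F x).
Proof.
move=> [cD _ _] cF; elim/(well_founded_ind ord_lt_wf): x => x.
case: x / ordP => [_|x xT IH|x xlim IH].
- by rewrite iter_derivative0.
- by rewrite iter_derivative_succ//; apply: cD; apply: IH; exact: ord_lt_succ.
- by rewrite iter_derivative_limit//; apply: closed_bigI.
Qed.

(** The iterates of [D] stay inside those of [E]: at a successor, pass from [D] to [E] and then use
    monotonicity of [E]. Both moves need the iterates to be closed. *)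
Lemma derivative_rank_mono {X : topologicalType} (D E : set X -> set X) :
  derivative D -> derivative E -> (forall F, closed F -> D F `<=` E F) ->
  derivative_rank D <= derivative_rank E.
Proof.
move=> dD dE DE; apply: ord_min_mono => x /= Ex0; exists x => //=.
rewrite -subset0 -Ex0; move: {Ex0} x => x.
have cI (G : set X -> set X) y (dG : derivative G) :=
  closed_iter_derivative G setT y dG closedT.
elim/(well_founded_ind ord_lt_wf): x => x; case: x / ordP => [_|x xT IH|x xlim IH].
- by rewrite !iter_derivative0.
- rewrite !iter_derivative_succ//; move=> t /(DE _ (cI _ _ dD)).
  by case: (dE) => _ _ mE; apply: mE; [exact: cI|exact: cI|exact/IH/ord_lt_succ].
- rewrite !iter_derivative_limit// => t Dt y yx; apply: (IH y yx); exact: Dt.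
Qed.

(** If [x] is in both closures, every neighbourhood of [x] meets [F] in points with [f <= p] and in
    points with [f >= q], so the oscillation is at least [q - p]. *)
Lemma alpha_rank_le_beta_rank {R : realType} {X : topologicalType} (f : X -> R) :
  alpha_rank f <= beta_rank f.
Proof.
apply: ord_sup_mono => -[p q] /= pq; exists (ratr q - ratr p)%R.
  by rewrite /= subr_gt0 ltr_rat.
apply: derivative_rank_mono;
  [exact: separation_derivativeP|exact: oscillation_derivativeP|].
move=> F cF x [xA xB]; split.
  by rewrite ((closure_id F).1 cF); apply: closureS xA => y [].
apply: le_ereal_inf_tmp => _ [U oU <-].
have [a [[Fa /= fa] Ua]] := xA U (open_nbhs_nbhs oU).
have [b [[Fb /= fb] Ub]] := xB U (open_nbhs_nbhs oU).
apply: (@le_trans _ _ `|f b - f a|%:E); last first.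
  by apply: ereal_sup_ubound; exists (b, a).
rewrite lee_fin; apply: le_trans (ler_norm _); exact: lerB.
Qed.

Lemma beta_rank_le_gamma_rank {R : realType} {X : topologicalType} (f : X -> R) :
  beta_rank f <= gamma_rank f.
Proof.
rewrite /gamma_rank; set A := mkset _.
have [A0|/set0P] := eqVneq A set0; last first.
  move=> /ord_minP[[fs [cfs fsf ->]] _].
  apply: ord_sup_mono => e /= e0; exists (e / 4)%R; first by rewrite /= divr_gt0.
  apply: derivative_rank_mono;
    [exact: oscillation_derivativeP|exact: convergence_derivativeP|].
  move=> F _ x [Fx osc]; split=> //=; rewrite leNgt; apply/negP.
  move=> /ereal_inf_lt[_ [U [oU Ux] <-]] /ereal_inf_lt[_ [N _ <-]] Nlt.
  (* Letting [m] tend to infinity in the tail bound puts [f] within [e / 4] of [fs N] on [U] inside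
     [F]. *)
  have fN y : U y -> F y -> (`|f y - fs N y| <= e / 4)%R.
    move=> Uy Fy; have cv : `|fs m y - fs N y|%R @[m --> \oo] --> `|f y - fs N y|%R.
      by apply: cvg_norm; apply: cvgB; [exact: fsf|exact: cvg_cst].
    apply: (cvgr_to_le cv); exists N => // m /= Nm.
    rewrite -lee_fin; apply: le_trans (ltW Nlt); apply: ereal_sup_ubound.
    by exists m, N, y.
  (* As [fs N] is within [e / 16] of [fs N x] on [V], two values of [f] differ by at most
     [2 * (e / 4 + e / 16)], that is [5 * e / 8], which is below [e - e / 4]. *)
  have e16 : (0 < e / 16)%R by rewrite divr_gt0.
  have /cvgr_dist_lt/(_ _ e16) := cfs N x.
  rewrite nbhsE => -[V [oV Vx] Ve].
  suff : (oscillation f x F <= (e - e / 4)%:E)%E.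
    by move/(le_trans osc); rewrite lee_fin; lra.
  apply: (@le_trans _ _ (ereal_sup [set `|f y.1 - f y.2|%:E | y in
      ((U `&` V) `&` F) `*` ((U `&` V) `&` F)])).
    apply: ereal_inf_lbound; exists (U `&` V) => //.
    by split; [exact: openI|split].
  apply: ge_ereal_sup => _ [[y z] [[[/= Uy Vy] Fy] [[/= Uz Vz] Fz]] <-].
  rewrite lee_fin; have := fN _ Uy Fy; have := fN _ Uz Fz.
  have /= := Ve _ Vy; have /= := Ve _ Vz.
  rewrite !ltr_distl !ler_distl => /andP[? ?] /andP[? ?] /andP[? ?] /andP[? ?].
  by apply/andP; split; lra.
(* If no sequence of continuous functions converges to [f], then [gamma_rank f] is [\top]. *)
by rewrite A0 /ord_min xgetPN ?lex1// => y [].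
Qed.

(** * Stratified functions *)

(* The level sets of [t] are the strata: [{t >= k}] is closed, and on each
   stratum [fs] is locally eventually equal to [h]. *)
Definition stratified {R : realType} {X : topologicalType} (h : X -> R) : Prop :=
  exists (M : nat) (t : X -> nat) (fs : nat -> X -> R),
    [/\ forall x, (t x <= M)%N, forall n, continuous (fs n) &
        forall x, exists N, \forall y \near x, (t y <= t x)%N /\
          (t y = t x -> forall n, (N <= n)%N -> fs n y = h y)].

Lemma stratified_continuous {R : realType} {X : topologicalType} (h : X -> R) :
  continuous h -> stratified h.
Proof.
move=> ch; exists 0%N, (fun=> 0%N), (fun=> h); split=> // x; exists 0%N.
exact: nearW.
Qed.

(** The levels are added: if the sums agree and neither level rises above its value at [x], then
    both levels agree. *)
Lemma stratified_op {R : realType} {X : topologicalType} (op : R * R -> R)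
    (g h : X -> R) : continuous op -> stratified g -> stratified h ->
  stratified (fun x => op (g x, h x)).
Proof.
move=> cop [M [t [fs [tM cfs fst]]]] [M' [t' [fs' [tM' cfs' fst']]]].
exists (M + M')%N, (fun x => t x + t' x)%N, (fun n x => op (fs n x, fs' n x)).
split=> [x|n x|x]; first exact: leq_add.
  apply: (@continuous_comp _ _ _ (fun x => (fs n x, fs' n x)) op); last exact: cop.
  exact: (cvg_pair (cfs n x) (cfs' n x)).
have [[N xN] [N' xN']] := (fst x, fst' x); exists (maxn N N').
apply: filterS2 xN xN' => y [ty tyE] [ty' tyE']; split; first exact: leq_add.
move=> tt n; rewrite geq_max => /andP[Nn Nn'].
by rewrite tyE ?tyE'//; lia.
Qed.

Lemma stratified_gamma {R : realType} {X : topologicalType} (h : X -> R) :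
  stratified h -> gamma_rank h <= ord_omega.
Proof.
move=> [M [t [fs [tM cfs fst]]]].
apply: (@le_trans _ _ (ord_sup [set derivative_rank (convergence_derivative fs e)
                | e in [set e : R | (0 < e)%R]])).
  apply: ord_min_le; exists fs; split=> // x.
  have [N /nbhs_singleton[_ /(_ erefl) fN]] := fst x.
  by apply: cvg_near_cst; exists N.
apply/ord_supP => _ [e /= e0 <-].
apply: le_trans (ord_of_nat_le_omega M.+1); apply: ord_min_le => /=.
(* Inside [{t >= k}], points near an [x] of level [k] also have level [k], so the tail oscillation
   at [x] vanishes and [x] is removed. *)
have tk k : iter_derivative (convergence_derivative fs e) setT (ord_of_nat k) `<=`
    [set x | (k <= t x)%N].
  elim: k => [//|k IH].
  rewrite [ord_of_nat _]/= iter_derivative_succ ?ord_of_nat_lt_top//.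
  move=> x [/IH /= kx ex]; rewrite ltn_neqAle kx andbT; apply/eqP => kE.
  move: ex => /=; apply/negP; rewrite -ltNge.
  have [N] := fst x; rewrite /prop_near1 nbhsE => -[U xU UN].
  apply: (@le_lt_trans _ _ 0%E); last by rewrite lte_fin.
  apply: le_trans (ereal_inf_lbound _) _; first by exists U.
  apply: le_trans (ereal_inf_lbound _) _; first by exists N.
  apply: ge_ereal_sup => _ [m [n [y [Nm Nn [/UN[yx yE] /IH /= ky] ->]]]].
  by rewrite !yE ?subrr ?normr0//; apply/eqP; rewrite eqn_leq yx -kE.
by rewrite -subset0 => x /(tk M.+1) /=; rewrite ltnNge tM.
Qed.

Lemma stratified_baire1 {R : realType} {X : topologicalType} (h : X -> R) :
  stratified h -> baire_class (ord_of_nat 1) h.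
Proof.
move=> [M [t [fs [tM cfs fst]]]]; apply/baire_class1P; exists fs => // x.
have [N /nbhs_singleton[_ /(_ erefl) fN]] := fst x.
by apply: cvg_near_cst; exists N.
Qed.

Section metric.
Context {R : realType} {X : topologicalType} (d : X -> X -> R).
Hypothesis dP : compatible_metric d.

Let dist (A : set X) x : R := inf [set d x a | a in A].

Let distD A x y : A !=set0 -> (dist A x <= d x y + dist A y)%R.
Proof.
case: dP => d0 _ _ dtri _ [a Aa]; rewrite -lerBlDl; apply: lb_le_inf.
  by exists (d y a), a.
move=> _ [b Ab <-]; rewrite lerBlDl; apply: le_trans (dtri x y b).
by apply: ge_inf; [exists 0%R => _ [c _ <-]|exists b].
Qed.

Let dist_continuous A : A !=set0 -> continuous (dist A).
Proof.
move=> A0 x; apply/cvgrPdist_lt => e e0; case: dP => _ _ dC _ /(_ x) xd.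
apply/xd; exists e => // y /= dxy.
have := distD _ x y A0; have := distD _ y x A0; rewrite (dC y x) => ? ?.
by rewrite ltr_norml; apply/andP; split; lra.
Qed.

Lemma stratified_indic (A : set X) : closed A -> stratified (\1_A : X -> R)%R.
Proof.
move=> cA; have [->|/set0P A0] := eqVneq A set0.
  by rewrite indic0; apply: stratified_continuous => x; apply: cvg_cst.
pose z n x : R := (1 - n%:R * dist A x)%R.
(* The positive part of [z n] is [1] on [A] and tends to [0] elsewhere; level [1] is [A] and level
   [0] its open complement. *)
exists 1%N, (fun x => (x \in A) : nat), (fun n x => (z n x + `|z n x|) / 2)%R.
have zc n : continuous (z n).
  move=> x; apply: cvgB; first exact: cvg_cst.
  by apply: cvgMr; exact: dist_continuous.
split=> [x|n x|x]; first by case: (x \in A).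
  apply: cvgMl; apply: cvgD; [exact: zc|apply: cvg_norm; exact: zc].
case: dP => d0 dE dC dtri nb.
have [xA|xA] := boolP (x \in A).
  exists 0%N; apply: nearW => y; split; first by case: (y \in A).
  move=> yA n _; rewrite indicE yA.
  have {}yA : A y by apply/set_mem; move: yA; case: (y \in A).
  have D0 : dist A y = 0%R.
    apply/eqP; rewrite eq_le; apply/andP; split.
      apply: ge_inf; first by exists 0%R => _ [c _ <-].
      by exists y => //; apply/dE.
    by apply: lb_le_inf; [exists (d y y), y|move=> _ [c _ <-]].
  by rewrite /z D0 mulr0 subr0 normr1 -mulr2n mulfV.
have : nbhs x (~` A).
  by apply: open_nbhs_nbhs; split; [exact: closed_openC|move/mem_set; exact/negP].
(* On the ball of radius [e / 2] around [x], [dist A] is at least [e / 2], so [n * dist A] reaches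
   [1] once [n >= 2 / e]. *)
move=> /nb[e e0 eA]; exists (Num.truncn (2 / e)).+1.
have De : (e <= dist A x)%R.
  case: A0 => a Aa; apply: lb_le_inf; first by exists (d x a), a.
  by move=> _ [b Ab <-]; rewrite leNgt; apply/negP => /eA.
apply/nb; exists (e / 2)%R; first by rewrite divr_gt0.
move=> y /= xy.
have yA : y \notin A.
  by apply/negP => /set_mem; apply: eA; rewrite /=; lra.
rewrite (negbTE yA); split=> // _ n Nn; rewrite indicE (negbTE yA).
have Dy : (e / 2 <= dist A y)%R by have := distD _ x y A0; lra.
have n2 : (2 / e <= n%:R)%R.
  apply: le_trans (ltW (truncnS_gt _)) _; by rewrite ler_nat.
have z0 : (z n y <= 0)%R.
  rewrite subr_le0; apply: (@le_trans _ _ (2 / e * (e / 2))%R).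
    by rewrite mulrA mulfVK ?gt_eqF// mulfV.
  by apply: ler_pM; rewrite ?divr_ge0// ltW.
by rewrite ler0_norm// subrr mul0r.
Qed.

End metric.

(** * Approximation of Baire class 2 functions *)

(** For an index [K] and a rational [q], the points where all [fs k] with [k >= K] stay within [e]
    of [q] form a closed set, and the bound passes to the limit [g]. Such pairs are coded by
    naturals; other codes get the empty set. *)
Lemma baire_class1_cover {R : realType} {X : topologicalType} (g : X -> R) (e : R) :
  (0 < e)%R -> baire_class (ord_of_nat 1) g ->
  exists Ac : (nat -> set X) * (nat -> R), [/\ forall j, closed (Ac.1 j),
    forall x, exists j, Ac.1 j x &
    forall j x, Ac.1 j x -> (`|g x - Ac.2 j| <= e)%R].
Proof.
move=> e0 /baire_class1P[fs cfs fsg].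
pose B (p : nat * rat) := \bigcap_(k in [set k | (p.1 <= k)%N])
  [set x | (`|fs k x - ratr p.2| <= e)%R].
pose A j := if unpickle j is Some p then B p else set0.
pose c j : R := if unpickle j is Some p then ratr (p : nat * rat).2 else 0%R.
exists (A, c); split=> /= [j|x|j x].
- rewrite /A; case: unpickle => [p|]; last exact: closed0.
  apply: closed_bigI => k _.
  apply: (@closed_comp _ _ (fun x => `|fs k x - ratr p.2|%R) [set y | (y <= e)%R]).
    by move=> x _; apply: cvg_norm; apply: cvgB; [exact: cfs|exact: cvg_cst].
  exact: closed_le.
- have e2 : (0 < e / 2)%R by rewrite divr_gt0.
  have [q] := @rat_in_itvoo R (g x) (g x + e / 2)%R ltac:(by rewrite ltrDl).
  rewrite in_itv /= => /andP[gq qg].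
  have /cvgrPdist_lt/(_ _ e2)[K _ fK] := fsg x.
  exists (pickle (K, q)); rewrite /A pickleK => k /= Kk.
  have := fK k Kk; rewrite ltr_norml ler_norml => /andP[? ?].
  by apply/andP; split; lra.
- rewrite /A /c; case: unpickle => [p|//] Bx.
  have cv : `|fs m x - ratr p.2|%R @[m --> \oo] --> `|g x - ratr p.2|%R.
    by apply: cvg_norm; apply: cvgB; [exact: fsg|exact: cvg_cst].
  by apply: (cvgr_to_le cv); exists p.1.
Qed.

Section metric.
Context {R : realType} {X : topologicalType} (d : X -> X -> R).
Hypothesis dP : compatible_metric d.

(** Written as [h + 1_A * (c - h)], the selection is a continuous function of the indicator and [h],
    so [stratified_op] applies. *)
Lemma stratified_if (A : set X) (c : R) (h : X -> R) : closed A -> stratified h ->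
  stratified (fun x => if x \in A then c else h x).
Proof.
move=> cA sh; pose op (p : R * R) : R := (p.2 + p.1 * (c - p.2))%R.
have -> : (fun x => if x \in A then c else h x) =
    (fun x => op ((\1_A : X -> R)%R x, h x)).
  by apply/funext => x; rewrite /op indicE /=; case: (x \in A); rewrite /=; ring.
apply: stratified_op => //; last exact: stratified_indic dP _ cA.
move=> p; apply: cvgD; first exact: cvg_snd.
by apply: cvgM; [exact: cvg_fst|apply: cvgB; [exact: cvg_cst|exact: cvg_snd]].
Qed.

Lemma stratified_add_indic (A : set X) (a : R) (h : X -> R) : closed A -> stratified h ->
  stratified (fun x => h x + a * (\1_A : X -> R) x)%R.
Proof.
move=> cA sh; pose op (p : R * R) : R := (p.2 + a * p.1)%R.
apply: (stratified_op op (\1_A : X -> R)%R h) => //; last exact: stratified_indic dP _ cA.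
by move=> p; apply: cvgD; [exact: cvg_snd|apply: cvgMr; exact: cvg_fst].
Qed.

(** Levels are processed in increasing order, each overwriting earlier values on its first [N]
    pieces. A point already caught keeps its value or receives one from a later level. *)
Lemma stratified_select (A : nat -> nat -> set X) (c : nat -> nat -> R) (N K : nat) :
  (forall n j, closed (A n j)) ->
  exists2 h : X -> R, stratified h & forall x n j, (n < K)%N -> (j < N)%N -> A n j x ->
    exists n' j', [/\ (n <= n')%N, A n' j' x & h x = c n' j'].
Proof.
move=> cA; elim: K => [|K [h sh hP]].
  by exists (fun=> 0%R) => //; apply: stratified_continuous => x; apply: cvg_cst.
have [h' sh' [h'A h'h]] : exists2 h' : X -> R, stratified h' &
    (forall x j, (j < N)%N -> A K j x -> exists2 j', A K j' x & h' x = c K j') /\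
    (forall x, h' x = h x \/ exists2 j', A K j' x & h' x = c K j').
  elim: (N) => [|J [h' sh' [h'A h'h]]]; first by exists h => //; split=> // x; left.
  exists (fun x => if x \in A K J then c K J else h' x); first exact: stratified_if.
  split=> [x j|x]; case: ifPn => [/set_mem xA|xA].
  - by exists J.
  - rewrite ltnS leq_eqVlt => /predU1P[->|]; last exact: h'A.
    by move/mem_set; rewrite (negbTE xA).
  - by right; exists J.
  - exact: h'h.
exists h' => // x n j; rewrite ltnS leq_eqVlt => /predU1P[->|nK] jN xA.
  by have [j' ? ?] := h'A x j jN xA; exists K, j'.
have [->|[j' ? ?]] := h'h x; first exact: hP xA.
by exists K, j'; split=> //; exact: ltnW.
Qed.

(* The [N]-th approximation only looks at the first [N] pieces of the first [N]
   covers and trusts the finest cover that has already caught the point. *)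
Lemma baire_class2_stratified (f : X -> R) : baire_class (ord_of_nat 2) f ->
  exists2 hs : nat -> X -> R, forall n, stratified (hs n) & pointwise_cvg hs f.
Proof.
move=> /(baire_class_succP _ _ (ord_of_nat_lt_top 1))[fs cfs fsf].
have /choice[Ac AcP] : forall n, exists Ac : (nat -> set X) * (nat -> R),
    [/\ forall j, closed (Ac.1 j), forall x, exists j, Ac.1 j x &
      forall j x, Ac.1 j x -> (`|fs n x - Ac.2 j| <= n.+1%:R^-1)%R].
  by move=> n; apply: baire_class1_cover; rewrite ?invr_gt0 ?ltr0Sn.
pose A n := (Ac n).1; pose c n := (Ac n).2.
have /choice[hs hsP] : forall N, exists h : X -> R, stratified h /\
    forall x n j, (n < N)%N -> (j < N)%N -> A n j x ->
    exists n' j', [/\ (n <= n')%N, A n' j' x & h x = c n' j'].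
  move=> N; have [|h sh hP] := @stratified_select A c N N; last by exists h.
  by move=> n j; have [cA _ _] := AcP n; exact: cA.
exists hs => [n|x]; first by case: (hsP n).
apply/cvgrPdist_lt => e e0.
have e2 : (0 < e / 2)%R by rewrite divr_gt0.
have /cvgrPdist_lt/(_ _ e2)[m _ fm] := fsf x.
have [p _ pe] : \forall n \near \oo, (n.+1%:R^-1 < e / 2)%R
  by exact: near_infty_natSinv_lt (PosNum e2).
(* From [m] on, [fs n'] is within [e / 2] of [f] at [x]; from [p] on, the cover error is below
   [e / 2]. The level [n'] actually selected is known only to be at least [n]. *)
pose n := maxn m p; have [_ /(_ x)[j xAj] _] := AcP n.
exists (maxn n j).+1 => // N /=; rewrite gtn_max => /andP[nN jN].
have [_ /(_ x n j nN jN xAj)[n' [j' [nn' xA ->]]]] := hsP N.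
have [_ _ /(_ j' x xA)] := AcP n'.
have := pe n' (leq_trans (leq_maxr _ _) nn').
have := fm n' (leq_trans (leq_maxl _ _) nn').
rewrite /c /=; set u := (n'.+1%:R^-1)%R; set v := (Ac n').2 j'.
rewrite !ltr_norml ler_norml => /andP[? ?] ? /andP[? ?].
by apply/andP; split; lra.
Qed.

End metric.

(** * Bounding the limit ranks *)

(** [P] marks the terms whose exact Baire class has to be altered; the others stay unchanged. *)
Lemma pointwise_cvg_perturb {R : realType} {X : topologicalType}
    (fs : nat -> X -> R) (f g : X -> R) (P : pred nat) :
  pointwise_cvg fs f ->
  pointwise_cvg (fun n x => fs n x + (if P n then n.+1%:R^-1 else 0) * g x)%R f.
Proof.
move=> fsf x; rewrite -[f x]addr0 -[X in (_ + X)%R](mul0r (g x)).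
apply: cvgD; first exact: fsf.
apply: cvgMl; apply/cvgrPdist_lt => e e0.
have [p _ pe] : \forall n \near \oo, (n.+1%:R^-1 < e)%R
  by exact: near_infty_natSinv_lt (PosNum e0).
exists p => // n /pe ne /=; rewrite sub0r normrN; case: (P n); last by rewrite normr0.
by rewrite ger0_norm ?invr_ge0.
Qed.

(** By induction on the derivation the approximants are of class [1], so their limit is of class
    [2], hence of class [1]. *)
Lemma baire_class_collapse {R : realType} {X : topologicalType} :
  (forall g : X -> R, baire_class (ord_of_nat 2) g -> baire_class (ord_of_nat 1) g) ->
  forall x (g : X -> R), baire_class x g -> baire_class (ord_of_nat 1) g.
Proof.
move=> col x g; elim=> [{}g cg|{}x xs gs {}g _ _ gs1 gsg].
  exact: baire_classW (le0x _) (Baire0 cg).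
by apply/col/(baire_class_succP _ _ (ord_of_nat_lt_top 1)); exists gs.
Qed.

Lemma baire_class_least {R : realType} {X : topologicalType} x (g : X -> R) :
  baire_class x g -> exists y, [/\ y <= x, baire_class y g &
    forall z, z < y -> ~ baire_class z g].
Proof.
move=> xg; have [yg ymin] := ord_minP (ex_intro (fun z => baire_class z g) x xg).
exists (ord_min [set z | baire_class z g]); split=> //; first exact: ymin.
by move=> z zy /ymin; rewrite leNgt zy.
Qed.

Lemma baire_class1_cancel {R : realType} {X : topologicalType} (a : R) (f g : X -> R) :
  a != 0%R -> baire_class (ord_of_nat 1) f ->
  baire_class (ord_of_nat 1) (fun x => f x + a * g x)%R ->
  baire_class (ord_of_nat 1) g.
Proof.
move=> a0 f1 fg1; have c1 : baire_class (ord_of_nat 1) (fun _ : X => 0%R : R).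
  by apply: baire_classW (le0x _) (Baire0 _) => x; apply: cvg_cst.
have := baire_class1_lin a^-1 _ _ c1 (baire_class1_lin (-1) _ _ fg1 f1).
congr baire_class; apply/funext => x; field; exact: a0.
Qed.

Lemma compatible_closed1 {R : realType} {X : topologicalType} (d : X -> X -> R) x :
  compatible_metric d -> closed ([set x] : set X).
Proof.
move=> [d0 dE dC dtri nb]; rewrite -[[set x]]setCK; apply: open_closedC.
rewrite openE => y /= yx; rewrite /interior; apply/nb; exists (d y x).
  by rewrite lt_neqAle d0 andbT eq_sym; apply/eqP => /dE.
by move=> z /= yz zx; move: yz; rewrite zx ltxx.
Qed.

(** If all these indicators were continuous, every singleton would be open and a countable dense set
    would be all of [X]. *)
Lemma polish_indic1_discontinuous {R : realType} {X : topologicalType} :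
  polish_space R X -> ~ countable [set: X] ->
  exists x, ~ continuous (\1_[set x] : X -> R)%R.
Proof.
move=> [[D cD dD] _] uX; apply: contrapT => nx; apply: uX.
apply: sub_countable cD; apply: subset_card_le => x _.
have cx : continuous (\1_[set x] : X -> R)%R.
  by apply: contrapT => ncx; apply: nx; exists x.
have ox : open [set x].
  rewrite (_ : [set x] = (\1_[set x] : X -> R)%R @^-1` [set y | (0 < y)%R]).
    by apply: open_comp => //; exact: open_gt.
  apply/seteqP; split=> y /=; rewrite indicE.
    by move=> ->; rewrite mem_set.
  by case: (boolP (y \in [set x])) => [/set_mem//|_]; rewrite ltxx.
by have [|y [/= -> ]] := dD [set x] _ ox; first by exists x.
Qed.

Section gamma.
Context {R : realType} {X : topologicalType}.
Hypotheses (polishX : polish_space R X) (uncountableX : ~ countable [set: X]).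

Lemma gamma_rank2_le_omega (f : X -> R) : baire_class (ord_of_nat 2) f ->
  limit_rank gamma_rank (ord_of_nat 2) f <= ord_omega.
Proof.
have [_ [d dP _]] := polishX.
move=> /(baire_class2_stratified _ dP)[hs shs hsf].
rewrite -[ord_of_nat 2]/(ord_succ (ord_of_nat 1)) limit_rank_succ; last first.
  by rewrite ord_lt_0_1 ord_of_nat_lt_top.
apply: (@le_trans _ _ (ord_sup (range (fun n =>
    limit_rank gamma_rank (ord_of_nat 1) (hs n))))).
  by apply: ord_min_le; exists hs; split=> // n; exact: stratified_baire1.
by apply/ord_supP => _ [n _ <-]; rewrite limit_rank1; exact: stratified_gamma.
Qed.

Lemma limit_gamma_rank_limit_le_omega (x : Ord1) (f : X -> R) :
  limit_ord x -> ord_of_nat 2 < x ->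
  (forall y (g : X -> R), ord_of_nat 2 <= y < x -> baire_class y g ->
     limit_rank gamma_rank y g <= ord_omega) ->
  baire_class x f -> limit_rank gamma_rank x f <= ord_omega.
Proof.
move=> xlim x2 IH xf; have [_ [d dP _]] := polishX.
have x1 : ord_of_nat 1 < x.
  by apply: lt_trans x2; exact/ord_lt_succ/ord_of_nat_lt_top.
suff [hs [xs [xsx xhs xhs' hsf rk]]] : exists (hs : nat -> X -> R) (xs : nat -> Ord1),
    [/\ forall n, \bot < xs n < x, forall n, baire_class (xs n) (hs n),
        forall n z, z < xs n -> ~ baire_class z (hs n), pointwise_cvg hs f &
        forall n, limit_rank gamma_rank (xs n) (hs n) <= ord_omega].
  rewrite limit_rank_limit//.
  apply: (@le_trans _ _ (ord_sup (range (fun n => limit_rank gamma_rank (xs n) (hs n))))).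
    by apply: ord_min_le; exists hs, xs.
  by apply/ord_supP => _ [n _ <-].
have [[g [g2 g1]]|col] := pselect (exists g : X -> R,
    baire_class (ord_of_nat 2) g /\ ~ baire_class (ord_of_nat 1) g).
  have [xs [fs [xsx xfs fsf]]] := baire_classP _ _ (le_lt_trans (le0x _) x1) xf.
  pose P n := `[< baire_class (ord_of_nat 1) (fs n) >].
  pose hs n t : R := (fs n t + (if P n then n.+1%:R^-1 else 0) * g t)%R.
  have /choice[ys ysP] : forall n, exists y, [/\ ord_of_nat 2 <= y < x,
      baire_class y (hs n) & forall z, z < y -> ~ baire_class z (hs n)].
    move=> n.
    (* A term of class [1] is perturbed by [g] into one of class [2] but not [1]; any other term is
       kept, with its class [xs n]. *)
    have [y [yx yh h1]] : exists y, [/\ y < x, baire_class y (hs n) &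
        ~ baire_class (ord_of_nat 1) (hs n)].
      rewrite /hs /P; case: asboolP => [f1|nf1].
        exists (ord_of_nat 2); split=> //.
          apply: baire_class2_lin => //; apply: baire_classW f1.
          exact/ltW/ord_lt_succ/ord_of_nat_lt_top.
        by move/(baire_class1_cancel _ _ _ _ f1)/g1; apply; rewrite invr_eq0.
      by exists (xs n); split=> //; under eq_fun do rewrite mul0r addr0.
    (* The exact class is at least [2] since class [1] has been excluded. *)
    have [z [zy zh zmin]] := baire_class_least _ _ yh; exists z; split=> //.
    rewrite (le_lt_trans zy)// andbT; apply: ord_succ_le; rewrite ltNge.
    by apply/negP => z1; apply: h1; exact: baire_classW zh.
  exists hs, ys; split=> [n|n|n|//|n].
  - have [/andP[y2 ->] _ _] := ysP n; rewrite andbT; apply: lt_le_trans y2.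
    by apply: lt_trans ord_lt_0_1 _; exact/ord_lt_succ/ord_of_nat_lt_top.
  - by case: (ysP n).
  - by case: (ysP n).
  - exact: pointwise_cvg_perturb.
  - by have [y2 yh _] := ysP n; exact: IH.
have f1 : baire_class (ord_of_nat 1) f.
  apply: baire_class_collapse xf => g g2; apply: contrapT => g1.
  by apply: col; exists g.
have [hs shs hsf] := baire_class2_stratified d dP f
  (baire_classW _ _ _ (ltW (ord_lt_succ (ord_of_nat_lt_top 1))) f1).
have [a na] := polish_indic1_discontinuous polishX uncountableX.
pose g := (\1_[set a] : X -> R)%R.
pose P n := `[< continuous (hs n) >].
pose us n t : R := (hs n t + (if P n then n.+1%:R^-1 else 0) * g t)%R.
have sus n : stratified (us n).
  by apply: (stratified_add_indic d dP _ _ _ _ (shs n)); exact: compatible_closed1 _ dP.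
(* Every approximant has exact class [1], where the limit rank is [gamma_rank] itself. *)
exists us, (fun=> ord_of_nat 1); split=> [n|n|n z|//|n].
- by rewrite ord_lt_0_1.
- exact: stratified_baire1.
- rewrite (ord_lt_succE _ _ (ord_of_nat_lt_top 0)) lex0 => /eqP-> /baire_class0E.
  rewrite /us /P; case: asboolP => [ch|nh].
    move=> cu; apply: na.
    (* If [hs n] and [us n] were both continuous, the indicator would be a multiple of their
       difference. *)
    have -> : (\1_[set a])%R = (fun t => n.+1%:R * (us n t - hs n t))%R.
      apply/funext => t; rewrite /us /P; case: asboolP => // _.
      by rewrite -/g; field; rewrite addrC natr1.
    move=> t; apply: cvgMr; apply: cvgB; last exact: ch.
    have -> : us n = (fun t => hs n t + n.+1%:R^-1 * g t)%R; last exact: cu.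
    by apply/funext => s; rewrite /us /P; case: asboolP.
  by under eq_fun do rewrite mul0r addr0.
- exact: pointwise_cvg_perturb.
- by rewrite limit_rank1; exact: stratified_gamma.
Qed.

Lemma limit_gamma_rank_le_omega (x : Ord1) (f : X -> R) :
  ord_of_nat 2 <= x -> baire_class x f ->
  limit_rank gamma_rank x f <= ord_omega.
Proof.
elim/(well_founded_ind ord_lt_wf): x f => x.
case: x / ordP => [_ f|x xT IH f|x xlim IH f x2].
- have := lt_trans ord_lt_0_1 (ord_lt_succ (ord_of_nat_lt_top 1)).
  by move/lt_le_trans => /[apply]; rewrite ltxx.
- move=> x2; have {x2} : ord_of_nat 1 <= x.
    rewrite -ord_lt_succE//; apply: lt_le_trans x2.
    exact/ord_lt_succ/ord_of_nat_lt_top.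
  (* Class [2] is treated apart, as the induction hypothesis says nothing about class [1]. *)
  rewrite le_eqVlt => /predU1P[<-|x1]; first exact: gamma_rank2_le_omega.
  move=> /(baire_class_succP _ _ xT)[fs xfs fsf].
  rewrite limit_rank_succ; last by rewrite xT andbT (lt_trans ord_lt_0_1).
  apply: (@le_trans _ _ (ord_sup (range (fun n => limit_rank gamma_rank x (fs n))))).
    by apply: ord_min_le; exists fs.
  apply/ord_supP => _ [n _ <-]; apply: IH => //; first exact: ord_lt_succ.
  exact: ord_succ_le.
- apply: limit_gamma_rank_limit_le_omega => // [|y g /andP[y2 yx]]; last exact: IH.
  (* A limit ordinal differs from [2], the successor of [1]. *)
  rewrite lt_neqAle x2 andbT; apply/eqP => xE; case: xlim => _ /(_ (ord_of_nat 1)).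
  have -> : ord_succ (ord_of_nat 1) = x by rewrite -xE.
  by rewrite ltxx -xE; move=> /(_ (ord_lt_succ (ord_of_nat_lt_top 1))).
Qed.

End gamma.

Theorem theorem4p12 (R : realType) (X : topologicalType)
    (polishX : polish_space R X) (uncountableX : ~ countable [set: X])
    (xi : Ord1) (le2_xi : ord_of_nat 2 <= xi) (xi_lt_omega1 : xi < \top)
    (f : X -> R) (baire_f : baire_class xi f) :
  limit_rank alpha_rank xi f <= limit_rank beta_rank xi f /\
  limit_rank beta_rank xi f <= limit_rank gamma_rank xi f /\
  limit_rank gamma_rank xi f <= ord_omega.
Proof.
split; first exact: limit_rank_mono alpha_rank_le_beta_rank xi f.
split; first exact: limit_rank_mono beta_rank_le_gamma_rank xi f.
exact: limit_gamma_rank_le_omega.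
Qed.
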